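(* Let $\lambda$ be a partition of $n\in\mathbb{N}$. Then $\mathcal{S}_\alpha$ is F-multiplicity free for all $\alpha\in\langle\lambda\rangle$ if and only if $\lambda$ is one of: (i) $(n-k,1^k)$ with $0\le k\le n-1$; (ii) $(n-2-k,2,1^k)$ with $0\le k\le n-5$; (iii) $(2^a,1^{n-2a})$ with $2\le a\le 4$ and $2a\le n$; (iv) $(3,2,2,1^{n-7})$ with $n\ge 7$; (v) $(3,3)$, $(4,3)$, $(4,4)$.
   Context: $\langle\lambda\rangle$ denotes the set of all compositions whose parts, rearranged in weakly decreasing order, give $\lambda$; $i^m$ denotes $m$ consecutive parts equal to $i$. For $\alpha=(\alpha_1,\dots,\alpha_k)\vDash n$ let $\mathrm{set}(\alpha)=\{\alpha_1,\alpha_1+\alpha_2,\dots,\alpha_1+\cdots+\alpha_{k-1}\}$, and $F_\alpha=\sum x_{i_1}\cdots x_{i_n}$ over $i_1\le\cdots\le i_n$ with $i_j<i_{j+1}$ whenever $j\in\mathrm{set}(\alpha)$. The composition diagram of $\alpha$ has $\alpha_i$ left-justified cells in row $i$ (top to bottom). Cover relation on compositions: $\beta\lessdot\gamma$ if $\gamma=(1)\cdot\beta$ (new top row of one cell, existing rows keep their cells) or $\gamma$ is obtained from $\beta$ by adding $1$ to the leftmost part of $\beta$ equal to $k$, for some $k$ (a cell added at the right end of that row). A standard composition tableau (SCT) of shape $\alpha\vDash n$ comes from a chain $\emptyset=\alpha^{n+1}\lessdot\cdots\lessdot\alpha^1=\alpha$ by putting $i$ in the cell added from $\alpha^{i+1}$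 to $\alpha^i$. Its descent set is the set of $i$ with $i+1$ in a column weakly right of the column of $i$; $\mathrm{com}(T)$ is the composition with this set. The quasisymmetric Schur function is $\mathcal{S}_\alpha=\sum_T F_{\mathrm{com}(T)}$ over SCT $T$ of shape $\alpha$. A quasisymmetric function $\sum c_\beta F_\beta$ is F-multiplicity free if all $c_\beta\in\{0,1\}$. *)

(* Defs.v *)
From mathcomp Require Import all_boot all_order all_algebra finmap multiset.

Set Implicit Arguments.
Unset Strict Implicit.
Unset Printing Implicit Defensive.

Definition is_comp (a : seq nat) : bool := all (ltn 0) a.

Definition is_partition_of (n : nat) (l : seq nat) : bool :=
  [&& is_comp l, sorted geq l & sumn l == n].

Definition in_angle (l a : seq nat) : bool := is_comp a && (sort geq a == l).

Definition comp_set (a : seq nat) : seq nat :=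
  [seq sumn (take j a) | j <- iota 1 (size a).-1].

(* The composition of n with set D, for D an increasing sequence of integers
   in [1, n - 1]; see comp_setK. *)
Definition set_comp (n : nat) (D : seq nat) : seq nat :=
  if n is 0 then [::] else pairmap (fun x y => y - x) 0 (rcons D n).

(** Formal power series in x_0, x_1, x_2, ... with integer coefficients, given
    by their coefficients.  A monomial is the finite multiset of the indices of
    its variables, so that x_(i_1) ... x_(i_n) is seq_mset [:: i_1; ...; i_n]. *)
Definition power_series := {mset nat}%mset -> int.

Definition F_word (a s : seq nat) : bool :=
  sorted leq s && all (fun j => nth 0 s j.-1 < nth 0 s j) (comp_set a).

(* The coefficient of m is the number of admissible words i_1 <= ... <= i_n with
   x_(i_1) ... x_(i_n) = m.  All letters of such a word lie in the support of m,
   so words over that support suffice. *)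
Definition fundF (a : seq nat) : power_series := fun m =>
  (#|[set t : (sumn a).-tuple (finsupp m) |
      F_word a (map val t) & seq_mset (map val t) == m]|%:Z)%R.

Definition up_covers (b : seq nat) : seq (seq nat) :=
  (1 :: b) :: [seq incr_nth b (index k b) | k <- undup b].

Definition covered_by : rel (seq nat) := fun b c => c \in up_covers b.

(* Chains are listed from the largest composition a^1 = a down to the empty
   composition a^(n+1). *)
Definition is_chain (a : seq nat) (c : seq (seq nat)) : bool :=
  [&& c != [::], head [::] c == a, last [::] c == [::]
    & sorted (fun x y => covered_by y x) c].

(* A tableau is the sequence of its rows, from top to bottom; each row lists its
   entries from left to right. *)
Definition tableau := seq (seq nat).

Definition add_entry (i : nat) (b c : seq nat) (T : tableau) : tableau :=
  if c == 1 :: b then [:: i] :: T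
  else let r := find (fun p => p.1 != p.2) (zip b c) in
       set_nth [::] T r (rcons (nth [::] T r) i).

Fixpoint tableau_from (i : nat) (c : seq (seq nat)) : tableau :=
  if c is x :: c' then
    if c' is y :: _ then add_entry i y x (tableau_from i.+1 c') else [::]
  else [::].

Definition chain_tableau (c : seq (seq nat)) : tableau := tableau_from 1 c.

Definition is_SCT (a : seq nat) (T : tableau) : Prop :=
  exists2 c, is_chain a c & T = chain_tableau c.

Fixpoint all_chains (n : nat) : seq (seq (seq nat)) :=
  if n is n'.+1 then
    [seq x :: c | c <- all_chains n', x <- up_covers (head [::] c)]
  else [:: [:: [::]]].

(* The SCT of shape a, each listed once: see mem_SCTs. *)
Definition SCTs (a : seq nat) : seq tableau :=
  undup [seq chain_tableau c | c <- all_chains (sumn a) & head [::] c == a].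

Definition column (T : tableau) (i : nat) : nat :=
  index i (nth [::] T (find (fun r => i \in r) T)).

Definition descents (n : nat) (T : tableau) : seq nat :=
  [seq i <- iota 1 n.-1 | column T i <= column T i.+1].

Definition com (n : nat) (T : tableau) : seq nat := set_comp n (descents n T).

Definition QSchur (a : seq nat) : power_series := fun m =>
  (\sum_(T <- SCTs a) fundF (com (sumn a) T) m)%R.

(* The F_b form a basis of the quasisymmetric functions, so the expansion of f
   is unique up to terms with coefficient 0. *)
Definition F_multiplicity_free (f : power_series) : Prop :=
  exists (s : seq (seq nat)) (c : seq nat -> int),
    [/\ uniq s, all is_comp s,
        forall m, f m = (\sum_(b <- s) c b * fundF b m)%R
      & forall b, b \in s -> c b = 0%R \/ c b = 1%R].

Lemma fundF_seq_mset (a s : seq nat) :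
  size s = sumn a -> sorted leq s -> fundF a (seq_mset s) = (F_word a s)%:Z%R.
Proof.
move=> ss so; rewrite /fundF.
have uq (t : seq nat) : F_word a t -> seq_mset t = seq_mset s -> t = s.
  move=> /andP[st _] /eq_seq_msetP.
  exact: (sorted_eq leq_trans anti_leq).
have [ws|nws] := boolP (F_word a s); last first.
  congr Posz; apply/eqP; rewrite cards_eq0; apply/eqP/setP => t.
  rewrite !inE; apply/negP => /andP[wt /eqP /(uq _ wt) E].
  by move: nws; rewrite -E wt.
have supp x : x \in s -> x \in finsupp (seq_mset s).
  by move=> xs; rewrite msuppE (perm_mem (perm_eq_seq_mset s)).
have [t Et] : exists t : seq (finsupp (seq_mset s)), map val t = s.
  exists (pmap insub s); rewrite pmap_filter; last exact: insubK.
  by apply/all_filterP/allP => x /supp xs; rewrite /= insubT.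
have st : size t == sumn a by rewrite -(size_map val) Et ss.
congr Posz; apply/eqP/cards1P; exists (Tuple st); apply/setP => u.
rewrite !inE; apply/andP/eqP => [[wu /eqP /(uq _ wu) E]|->]; last by rewrite /= Et.
by apply/val_inj/(inj_map val_inj); rewrite E /= Et.
Qed.

Lemma comp_setK (n : nat) (D : seq nat) :
  path ltn 0 (rcons D n) ->
  [/\ is_comp (set_comp n D), sumn (set_comp n D) = n
    & comp_set (set_comp n D) = D].
Proof.
case: n => [|n]; first by rewrite rcons_path /= ltn0 andbF.
rewrite /set_comp; set f := fun x y => y - x; set m := n.+1 => H.
have gen z E : path ltn z E -> is_comp (pairmap f z E) /\
    forall j, j <= size E -> z + sumn (take j (pairmap f z E)) = nth 0 (z :: E) j.
  elim: E z => [|x E IH] z /=; first by split=> // -[] //= _; rewrite addn0.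
  case/andP=> zx /IH [IH1 IH2]; split; first by rewrite /is_comp /= subn_gt0 zx.
  case=> [|j] /=; first by rewrite addn0.
  by rewrite ltnS => /IH2 <-; rewrite addnA subnKC // ltnW.
have [H1 H2] := gen _ _ H.
have sz : size (pairmap f 0 (rcons D m)) = (size D).+1.
  by rewrite size_pairmap size_rcons.
split=> //.
  have := H2 (size D).+1; rewrite size_rcons leqnn add0n -sz take_size => -> //.
  by rewrite sz /= nth_rcons ltnn eqxx.
rewrite /comp_set sz /=; apply: (@eq_from_nth _ 0); first by rewrite size_map size_iota.
move=> j; rewrite size_map size_iota => jD.
rewrite (nth_map 0) ?size_iota // nth_iota // add1n.
have := H2 j.+1; rewrite size_rcons ltnS add0n => -> /=; last exact: ltnW.
by rewrite nth_rcons jD.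
Qed.

Lemma mem_all_chains (n : nat) (c : seq (seq nat)) :
  c \in all_chains n =
  [&& size c == n.+1, last [::] c == [::]
    & sorted (fun x y => covered_by y x) c].
Proof.
elim: n c => [|n IH] c.
  by rewrite /= inE; case: c => [|[|x c] [|y d]].
apply/allpairsPdep/idP => [[d [x [/[!IH] /and3P[s l o] xd ->]]]|].
  case: d s l o xd => // y d s l o xd.
  by apply/and3P; split; [rewrite eqSS | | apply/andP].
case: c => [|x [|y c]] //=.
case/and3P=> s l /andP[xy o]; exists (y :: c), x; split=> //.
by rewrite IH /= -eqSS s l o.
Qed.

Lemma covered_by_sumn (b c : seq nat) : covered_by b c -> sumn c = (sumn b).+1.
Proof.
rewrite /covered_by inE => /orP[/eqP-> //|/mapP[k]].
rewrite mem_undup => + ->; elim: b => [|x b IH] //=; rewrite inE.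
have [_ _|_ /IH] := eqVneq x k; first by [].
by rewrite /= => ->; rewrite addnS.
Qed.

Lemma mem_SCTs (a : seq nat) (T : tableau) : T \in SCTs a <-> is_SCT a T.
Proof.
rewrite mem_undup; split=> [/mapP[c]|[c cc ->]].
  rewrite mem_filter mem_all_chains => /and4P[h s l o] ->; exists c => //.
  by rewrite /is_chain h l o andbT; case: c s {h l o}.
apply: map_f; rewrite mem_filter mem_all_chains.
case/and4P: cc => n0 /[dup] h /eqP <- l o; rewrite eqxx l o !andbT /=.
case: c n0 l o {h} => // x c _ /=; rewrite eqSS.
elim: c x => [|y c IH] x /=; first by move/eqP->.
by move=> l /andP[/covered_by_sumn-> o]; rewrite eqSS; apply: IH.
Qed.

(* Main.v *)
Require Import Defs.
From mathcomp Require Import all_boot all_order all_algebra finmap multiset zify.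

(** An SCT is determined by the word of the columns of its entries 1, 2, ..., n,
    and its descents are the positions where this word does not decrease.  Since
    the F_b are linearly independent, S_a is F-multiplicity free iff no two words
    of shape a have the same descents.

    If two words of shape a have the same descents, this persists after adding
    the same cells to both, provided that the first of them is a new row or
    extends a longest row.  Hence the failure propagates from a partition to any
    larger one with a longer first row or with more rows, and nine small
    partitions generate all failures.

    Conversely, in a hook a cell outside column 0 always lies strictly right of
    all earlier ones, so the descents locate the new rows; they also count them,
    which rules out the only ambiguity for (m, 2, 1^k).  A row that keeps its
    single cell blocks all older rows of length 1, so for rows of length at most
    2 a word splits at such a row into independent factors, which leaves the
    words of shape (2^b), b <= 4.  A single part 3 adds one letter 2 that may move
    across such a row, but only to a bounded number of places, all told apart by
    the descents. *)

Set Implicit Arguments.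
Unset Strict Implicit.
Unset Printing Implicit Defensive.

(** * Column words *)

(** Columns are counted from 0, so a nonzero letter [k] is also the length of the row that it
    extends; [index] picks the leftmost such row. *)
Definition add_cell (k : nat) (b : seq nat) : option (seq nat) :=
  if k is 0 then Some (1 :: b)
  else if k \in b then Some (incr_nth b (index k b)) else None.

(* A word lists the columns of 1, 2, ..., n; as n is the first cell to be added,
   it is read from its last letter. *)
Definition grow (v : seq nat) (b : option (seq nat)) : option (seq nat) :=
  foldr (fun k => obind (add_cell k)) b v.

Lemma grow_cat u v b : grow (u ++ v) b = grow u (grow v b).
Proof. exact: foldr_cat. Qed.

Definition word_shape (w : seq nat) : option (seq nat) := grow w (Some [::]).

Definition des (w : seq nat) : seq bool :=
  if w is x :: s then pairmap leq x s else [::].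

Definition words_mf (a : seq nat) : Prop :=
  forall w1 w2, word_shape w1 = Some a -> word_shape w2 = Some a ->
    des w1 = des w2 -> w1 = w2.

Lemma incr_nth_cat (b1 b2 : seq nat) k :
  k \notin b1 ->
  incr_nth (b1 ++ k :: b2) (index k (b1 ++ k :: b2)) = b1 ++ k.+1 :: b2.
Proof.
move=> kb; rewrite index_cat (negPf kb) /= eqxx addn0.
by elim: b1 {kb} => //= x b1 ->.
Qed.

Lemma add_cell_cat (b1 b2 : seq nat) k :
  0 < k -> k \notin b1 ->
  add_cell k (b1 ++ k :: b2) = Some (b1 ++ k.+1 :: b2).
Proof.
case: k => // k _ kb; rewrite /add_cell mem_cat mem_head orbT.
by rewrite incr_nth_cat.
Qed.

Variant add_cell_spec (k : nat) (b a : seq nat) : Prop :=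
| AddRow of k = 0 & a = 1 :: b
| AddCell b1 b2 of 0 < k & k \notin b1 & b = b1 ++ k :: b2
    & a = b1 ++ k.+1 :: b2.

Lemma add_cellP k b a : add_cell k b = Some a -> add_cell_spec k b a.
Proof.
case: k => [[<-]|k]; first by left.
rewrite /add_cell; case: ifP => // kb [<-].
have [b1 [b2 [kb1 ->]]] : exists b1 b2, k.+1 \notin b1 /\ b = b1 ++ k.+1 :: b2.
  elim: b kb => //= x b IH; rewrite inE.
  have [<- _|nx /IH[b1 [b2 [n1 ->]]]] := eqVneq k.+1 x; first by exists [::], b.
  by exists (x :: b1), b2; rewrite inE negb_or nx.
by rewrite incr_nth_cat //; right with b1 b2.
Qed.

Lemma shape_consP k w a :
  word_shape (k :: w) = Some a ->
  exists2 b, word_shape w = Some b & add_cell_spec k b a.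
Proof.
rewrite /word_shape /=; case: (grow w _) => //= b /add_cellP; by exists b.
Qed.

Lemma shape_cons k w b : word_shape w = Some b -> word_shape (k :: w) = add_cell k b.
Proof. by rewrite /word_shape /= => ->. Qed.

Lemma size_shape w a : word_shape w = Some a -> size w = sumn a.
Proof.
elim: w a => [|k w IH] a; first by case=> <-.
case/shape_consP=> b /IH /= -> [_ -> //|b1 b2 _ _ -> ->].
by rewrite !sumn_cat /=; lia.
Qed.

Lemma shape_pos w a : word_shape w = Some a -> all (ltn 0) a.
Proof.
elim: w a => [|k w IH] a; first by case=> <-.
case/shape_consP=> b /IH hb [_ ->|b1 b2 _ _ eb ->]; first by rewrite /= hb.
by move: hb; rewrite eb !all_cat /= => /and3P[-> _ ->].
Qed.

(** A letter is the length of its row before the cell is added, and rows never shrink. *)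
Lemma letter_lt w a m : word_shape w = Some a -> all (geq m) a -> all (gtn m) w.
Proof.
elim: w a => [|k w IH] a //= /shape_consP[b sb].
case=> [-> ->|b1 b2 k0 _ eb ->].
  by move=> /= /andP[m0 /(IH _ sb) ->]; rewrite andbT.
rewrite all_cat /= => /and3P[h1 km h2]; rewrite km /=.
by apply: (IH b) => //; rewrite eb all_cat h1 /= h2 ltnW.
Qed.

Lemma des_cons k w : w != [::] -> des (k :: w) = (k <= head 0 w) :: des w.
Proof. by case: w. Qed.

Lemma size_des w : size (des w) = (size w).-1.
Proof. by case: w => //= x s; rewrite size_pairmap. Qed.

Lemma des_catl k v w1 w2 :
  (w1 == [::]) = (w2 == [::]) -> (k <= head k w1) = (k <= head k w2) ->
  des w1 = des w2 -> des (v ++ k :: w1) = des (v ++ k :: w2).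
Proof.
move=> e h d; elim: v => [|x v IH].
  by case: w1 w2 e h d => [|y1 w1] [|y2 w2] //= _ -> ->.
rewrite !cat_cons !des_cons ?IH; first by case: v {IH}.
  by case: v {IH}.
by case: v {IH}.
Qed.

(** * Enumeration of the words of a shape *)

Fixpoint all_words (n : nat) : seq (seq nat * seq nat) :=
  if n is n'.+1 then
    flatten [seq (0 :: p.1, 1 :: p.2) ::
      [seq (k :: p.1, incr_nth p.2 (index k p.2)) | k <- undup p.2]
    | p <- all_words n']
  else [:: ([::], [::])].

Definition words_of a := [seq p.1 | p <- all_words (sumn a) & p.2 == a].

Lemma mem_words_of w a : word_shape w = Some a -> w \in words_of a.
Proof.
move=> s; apply/mapP; exists (w, a) => //; rewrite mem_filter eqxx /=.
rewrite -(size_shape s); elim: w a s => [|k w IH] a /=; first by case=> <-.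
case/shape_consP=> b /IH m h; apply/flattenP.
exists ((0 :: w, 1 :: b) :: [seq (k :: w, incr_nth b (index k b)) | k <- undup b]).
  by apply/mapP; exists (w, b).
case: h => [-> ->|b1 b2 k0 kb eb ->]; first exact: mem_head.
rewrite inE; apply/orP; right; apply/mapP; exists k.
  by rewrite mem_undup eb mem_cat mem_head orbT.
by rewrite eb incr_nth_cat.
Qed.

Definition mf_check a := uniq (map des (words_of a)).

Lemma mf_checkP a : mf_check a -> words_mf a.
Proof.
rewrite /mf_check => u w1 w2 /mem_words_of s1 /mem_words_of s2.
elim: (words_of a) u s1 s2 => //= w s IH /andP[nw /IH{}IH].
rewrite !inE => /predU1P[->|s1] /predU1P[->|s2] // e; last exact: IH.
- by rewrite e map_f in nw.
- by rewrite -e map_f in nw.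
Qed.

(** * Multiplicity free families *)

Lemma ascent_of_max k w b :
  word_shape w = Some b -> all (geq k) b -> w != [::] -> (k <= head 0 w) = false.
Proof.
by move=> s /(letter_lt s); case: w {s} => //= x w /andP[xk _] _; lia.
Qed.

Lemma split_unique (p : pred nat) b1 b2 c1 c2 x y :
  count p (b1 ++ x :: b2) <= 1 -> p x -> p y ->
  b1 ++ x :: b2 = c1 ++ y :: c2 -> [/\ b1 = c1, x = y & b2 = c2].
Proof.
move=> + px py; elim: b1 c1 => [|u b1 IH] [|v c1] //=.
- by move=> _ [-> ->].
- by rewrite px => + [_ e]; rewrite e count_cat /= py; lia.
- by move=> + [e _]; rewrite count_cat /= e px py; lia.
- by move=> h [-> /IH[|-> -> ->]] //; lia.
Qed.

Lemma count0_all (p q : pred nat) s :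
  (forall x, ~~ p x -> q x) -> count p s = 0 -> all q s.
Proof.
move=> pq /eqP; rewrite -leqn0 leqNgt -has_count => /hasPn h.
by apply/allP => x /h /pq.
Qed.

Lemma nonempty_of_count (p : pred nat) w a :
  word_shape w = Some a -> 0 < count p a -> w != [::].
Proof. by case: w => // -[<-]. Qed.

(** A nonzero letter extends the only row longer than 1 in [a], so its cell lies strictly right of
    all others. *)
Lemma hook_ascent k w a :
  word_shape (k :: w) = Some a -> count (ltn 1) a <= 1 -> w != [::] ->
  (k <= head 0 w) = (k == 0).
Proof.
case/shape_consP=> b sb [-> //|b1 b2 k0 _ eb ->] c w0.
rewrite (ascent_of_max sb) //; first by lia.
move: c; rewrite eb count_cat all_cat /= => c.
by rewrite leqnn !(@count0_all (ltn 1)) //; try (move=> x /=); lia.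
Qed.

(** The first bit tells whether the last added cell opens a row or ends the only long row; either
    way the previous shape is known. *)
Lemma hook_mf a : count (ltn 1) a <= 1 -> words_mf a.
Proof.
move=> c w1; elim: w1 a c => [|k1 w1 IH] a c [|k2 w2] //.
- by case=> <- /size_shape.
- by move=> /size_shape + [e]; rewrite -e.
move=> s1 s2 d; have sz : size w1 = size w2.
  by apply: succn_inj; rewrite -[LHS]/(size (k1 :: w1)) (size_shape s1) -(size_shape s2).
(* A word of one letter has no bit, but its only cell is in column 0. *)
have [e1|n1] := eqVneq w1 [::].
  case: w2 sz s2 d => [|? ?]; rewrite e1 // => _ s2 _; congr cons.
  move: s1 s2; rewrite e1 => /shape_consP[_ [<-] [->|[]]] // _.
  by move=> /shape_consP[_ [<-] [->|[]]].
have n2 : w2 != [::] by case: (w1) (w2) n1 sz => [|? ?] [].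
move: d; rewrite !des_cons // (hook_ascent s1) // (hook_ascent s2) // => -[e d].
case/shape_consP: s1 => b sb [ek ea|b1 b2 k0 kb eb ea].
  case/shape_consP: s2 => b' sb' [ek' ea'|? ? ? ? ? ?]; last by lia.
  rewrite ea in ea' c; case: ea' => ea'; rewrite ek ek'; congr cons.
  by apply: (IH b) => //; rewrite ea'.
case/shape_consP: s2 => b' sb' [ek' ea'|b1' b2' k0' kb' eb' ea']; first by lia.
have [||||e1 [e2] e3] := @split_unique (ltn 1) b1 b2 b1' b2' k1.+1 k2.+1.
- by rewrite -ea.
- by [].
- by [].
- by rewrite -ea.
rewrite e2; congr cons; apply: (IH b) => //; last by rewrite sb' eb eb' e1 e2 e3.
by move: c; rewrite ea eb !count_cat /=; lia.
Qed.

(** By [hook_ascent] each new row gives a true bit, except the very first one, whose letter is last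
    in the word. *)
Lemma hook_des w a :
  word_shape w = Some a -> count (ltn 1) a <= 1 -> count id (des w) = (size a).-1.
Proof.
elim: w a => [|k w IH] a; first by case=> <-.
move=> s c; have := s; case/shape_consP=> b sb h.
have [e|n] := eqVneq w [::].
  move: sb h; rewrite e /= => -[<-] [_ -> //|b1 b2 _ _ eb ->].
  by case: b1 eb.
rewrite des_cons //= (hook_ascent s) // (IH b) //; last first.
  by case: h c => [_ ->|b1 b2 k0 _ -> ->] //; rewrite !count_cat /=; lia.
have b0 : b != [::].
  apply: contra n => /eqP e; move: (size_shape sb); rewrite e /= => h0.
  by rewrite -size_eq0 h0.
case: h => [-> ->|b1 b2 k0 _ -> ->] /=; first by case: (b) b0.
by rewrite !size_cat /=; lia.
Qed.

(** The bits of the two factors are blocks of those of the whole word, at positions fixed by the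
    lengths. *)
Lemma des_cat0 d1 d2 u1 u2 :
  size d1 = size d2 -> des (d1 ++ 0 :: u1) = des (d2 ++ 0 :: u2) ->
  size u1 = size u2 -> des d1 = des d2 /\ des u1 = des u2.
Proof.
elim: d1 d2 => [|x d1 IH] [|y d2] //.
  by move=> _ + su; case: u1 u2 su => [|z1 u1] [|z2 u2] //= _ [].
have nc (d u : seq nat) : d ++ 0 :: u != [::] by case: d.
move=> [sd] + su; rewrite !cat_cons (des_cons x (nc d1 u1)) (des_cons y (nc d2 u2)).
case=> e /(IH _ sd)/(_ su)[e1 e2]; split=> //.
by case: d1 d2 sd e e1 {IH} => [|z1 d1] [|z2 d2] //= _ e e1; rewrite ?e ?e1.
Qed.

(** While the separating row keeps its single cell, no row of [b] can pass from length 1 to 2. So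
    [b] is complete before that row is opened, and [x] is built afterwards. *)
Lemma word_split_at_one w x b :
  all (geq 2) b -> word_shape w = Some (x ++ 1 :: b) ->
  exists d u, [/\ w = d ++ 0 :: u, word_shape d = Some x & word_shape u = Some b].
Proof.
move=> b2; elim: w x => [|k w IH] x; first by case: x.
case/shape_consP=> a sa [-> |a1 a2 k0 ka ea e].
  case: x => [|y x] /= [].
    by move=> e; exists [::], w; rewrite sa e.
  move=> -> ea; rewrite -ea in sa; have [d [u [-> sd su]]] := IH _ sa.
  by exists (0 :: d), u; rewrite (shape_cons 0 sd).
(* The extended row is left of the separating one: it is not that row, as [k] is positive, and a row
   of [b] would force [k = 1], whose leftmost row is not in [b]. *)
have [x2 ex eb] : exists2 x2, x = a1 ++ k.+1 :: x2 & a2 = x2 ++ 1 :: b.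
  elim: a1 x ka e {ea} => [|y a1 IHa] [|z x] //=.
  - by move=> _ [ek]; rewrite -ek in k0.
  - by move=> _ [-> <-]; exists x.
  - move=> kn [ey eb]; have : k.+1 \in b by rewrite eb mem_cat mem_head orbT.
    move/(allP b2) => /= k2; have ek : k = 1 by lia.
    by rewrite ek -ey mem_head in kn.
  - rewrite inE negb_or => /andP[_ kn] [-> /(IHa _ kn)[x2 -> ->]].
    by exists x2.
have [d [u [-> sd su]]] : exists d u, [/\ w = d ++ 0 :: u,
    word_shape d = Some (a1 ++ k :: x2) & word_shape u = Some b].
  by apply: IH; rewrite sa ea eb -catA.
by exists (k :: d), u; rewrite (shape_cons k sd) add_cell_cat // ex.
Qed.

Lemma words_mf_cat x b :
  all (geq 2) b -> words_mf x -> words_mf b -> words_mf (x ++ 1 :: b).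
Proof.
move=> b2 mx mb w1 w2 /(word_split_at_one b2)[d1 [u1 [-> sd1 su1]]].
move=> /(word_split_at_one b2)[d2 [u2 [-> sd2 su2]]] d.
have [||ed eu] := des_cat0 _ d.
- by rewrite (size_shape sd1) (size_shape sd2).
- by rewrite (size_shape su1) (size_shape su2).
by rewrite (mx _ _ sd1 sd2 ed) (mb _ _ su1 su2 eu).
Qed.

Lemma first_one a : 1 \in a -> exists x b, a = x ++ 1 :: b /\ 1 \notin x.
Proof.
elim: a => // y a IH; rewrite inE.
have [<- _|ny /IH[x [b [-> xn]]]] := eqVneq 1 y; first by exists [::], a.
by exists (y :: x), b; rewrite inE negb_or ny.
Qed.

(** Splitting repeatedly at a part 1 leaves the shapes [nseq b 2] with [b] at most 4, which are
    enumerated. *)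
Lemma twos_mf a :
  all (ltn 0) a -> all (geq 2) a -> count (ltn 1) a <= 4 -> words_mf a.
Proof.
move: {2}(size a).+1 (ltnSn (size a)) => n.
elim: n a => // n IH a; rewrite ltnS => sa a0 a2 c.
have [/first_one[x [b [ea x1]]]|n1] := boolP (1 \in a).
  move: sa a0 a2 c; rewrite ea size_cat /= !all_cat count_cat /=.
  move=> sa /andP[x0 b0] /andP[x2 b2] c.
  by apply: words_mf_cat => //; apply: IH => //; lia.
have ea : a = nseq (size a) 2.
  apply/all_pred1P/allP => x xa; have := allP a0 _ xa; have := allP a2 _ xa.
  by have : x != 1 by [apply: contra n1 => /eqP<-]; rewrite /=; lia.
have : size a <= 4 by move: c; rewrite ea count_nseq /= size_nseq; lia.
rewrite {}ea; case: (size a) => [|[|[|[|[|]]]]] // _.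
all: by apply: mf_checkP; vm_compute.
Qed.

Lemma big_ascent k w a :
  word_shape (k :: w) = Some a -> count (ltn 2) a <= 1 -> 1 < k -> w != [::] ->
  (k <= head 0 w) = false.
Proof.
case/shape_consP=> b sb [-> //|b1 b2 k0 _ eb ->] c k1 w0.
rewrite (ascent_of_max sb) //.
move: c; rewrite eb count_cat all_cat /= => c.
by rewrite leqnn !(@count0_all (ltn 2)) //; try (move=> x /=); lia.
Qed.

Lemma tail_nonempty k w a :
  word_shape (k :: w) = Some a -> 0 < count (ltn 1) a -> w != [::].
Proof.
case: w => // /shape_consP[_ [<-] [_ ->|b1 b2 _ _ + _]] //.
by case: b1.
Qed.

(** If the descents agreed, then 1 would be followed by 0, as [k] gives no descent. So the row of
    length 2 is the top row of [a], and [k] is not 2. The next bit forces the letter after [k] to be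
    1. The remaining words have hook shapes with different numbers of rows but equal descents,
    against [hook_des]. *)
Lemma near_hook_cross k w1 w2 a :
  count (ltn 1) a = 2 -> count (ltn 2) a = 1 ->
  word_shape (1 :: w1) = Some a -> word_shape (k :: w2) = Some a -> 1 < k ->
  des (1 :: w1) <> des (k :: w2).
Proof.
move=> c1 c2 s1 s2 k1.
have n1 : w1 != [::] by apply: tail_nonempty s1 _; rewrite c1.
have n2 : w2 != [::] by apply: tail_nonempty s2 _; rewrite c1.
rewrite !des_cons // (big_ascent s2) ?c2 // => -[h d].
case/shape_consP: s1 => b sb [//|b1 b2 _ b1n eb ea].
case: w1 n1 h d sb => // -[|x] y _ // _ d sy; case/shape_consP: (sy) => B sB [_ e|//].
have {b1n eb} [e1 e2] : b1 = [::] /\ b2 = B.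
  move: b1n; case: b1 {ea} eb => [|z b1]; first by rewrite e => -[->].
  by rewrite e => -[<-].
rewrite {}e1 {}e2 /= in ea.
case/shape_consP: s2 => b' sb' [ek|g1 g2 _ kn eb' ea']; first by lia.
case: w2 n2 d sb' => // k3 y' _ d sb'.
have cB : count (ltn 1) B = 1 by move: c1; rewrite ea /=; lia.
have ny : y != [::] by apply: (nonempty_of_count (p := ltn 1) sB); rewrite cB.
have ny' : y' != [::].
  have := f_equal size d; rewrite !size_des /= => sz.
  by case: (y) (y') ny sz => [|? ?] [].
move: d; rewrite !des_cons // => -[h d].
have cb1 : count (ltn 1) b' = 2.
  by move: c1; rewrite ea' eb' !count_cat /=; lia.
have cb2 : count (ltn 2) b' = 1.
  move: c2; rewrite ea' eb' !count_cat /=.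
  case: g1 ea' kn {eb'} => [|z g1] /=; first by rewrite ea => -[]; lia.
  by rewrite ea inE => -[<- _]; lia.
have sz : size b' = (size B).+1.
  by have := f_equal size ea; rewrite ea' eb' !size_cat /=; lia.
(* The letter 0 of the first word makes this bit true; a letter above 1 would make it false. *)
have k32 : k3 <= 1.
  rewrite leqNgt; apply/negP => k3b.
  by have := big_ascent sb'; rewrite cb2 => /(_ isT k3b ny'); lia.
case/shape_consP: sb' => b'' sb'' [ek3 e3|e1 e2 k30 kn3 eb'' e3].
  move: eb'; rewrite e3; case: (g1) ea' => [|z g1'] /=; rewrite ea.
    by move=> []; lia.
  by move=> [<- _] [].
have ek3 : k3 = 1 by lia.
have := hook_des sB; rewrite cB => /(_ isT).
have -> : des y = des y' by [].
rewrite (hook_des sb''); last first.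
  by move: cb1; rewrite eb'' e3 ek3 !count_cat /=; lia.
have -> : size b'' = size b' by rewrite eb'' e3 !size_cat.
have : 0 < size B by case: (B) cB.
by rewrite sz /=; lia.
Qed.

(** Shape and descents determine the last added cell: a new row, the end of the long row or the end
    of the row of length 2. Removing it leaves a shape of the same kind, one with parts at most 2,
    or a hook. *)
Lemma near_hook_mf a :
  count (ltn 1) a = 2 -> count (ltn 2) a = 1 -> words_mf a.
Proof.
move=> c1 c2 w1; elim: w1 a c1 c2 => [|k1 w1 IH] a c1 c2 [|k2 w2] //.
- by case=> <- /size_shape.
- by move=> /size_shape + [e]; rewrite -e.
move=> s1 s2 d.
have n1 : w1 != [::] by apply: tail_nonempty s1 _; rewrite c1.
have n2 : w2 != [::] by apply: tail_nonempty s2 _; rewrite c1.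
have b1 := big_ascent s1; have b2 := big_ascent s2.
have x1 := @near_hook_cross k2 w1 w2 a c1 c2.
have x2 := @near_hook_cross k1 w2 w1 a c1 c2.
have := d; rewrite !des_cons // => -[h d'].
case/shape_consP: (s1) => b sb [ek ea|p1 p2 k0 kb eb ea];
  case/shape_consP: (s2) => b' sb' [ek' ea'|q1 q2 k0' kb' eb' ea'].
- rewrite ek ek'; congr cons; rewrite ea in ea' c1 c2.
  by case: ea' => ea'; apply: (IH b) => //; rewrite ea'.
- have [k2b|k2s] := ltnP 1 k2.
    by move: b2; rewrite c2 => /(_ isT k2b n2); rewrite -h ek.
  have e2 : k2 = 1 by lia.
  (* The top row of [a] has length 1 and is not the extended row, so the letter 1 would have found a
     row of length 1 further left. *)
  move: ea'; rewrite ea e2; case: (q1) kb' => [|z q] //=; rewrite inE e2.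
  by move=> zn [ez _]; rewrite -ez in zn.
- have [k1b|k1s] := ltnP 1 k1.
    by move: b1; rewrite c2 => /(_ isT k1b n1); rewrite h ek'.
  have e1 : k1 = 1 by lia.
  move: ea; rewrite ea' e1; case: (p1) kb => [|z q] //=; rewrite inE e1.
  by move=> zn [ez _]; rewrite -ez in zn.
have [k1b|k1s] := ltnP 1 k1; have [k2b|k2s] := ltnP 1 k2.
- have [||||e1 [e2] e3] := @split_unique (ltn 2) p1 p2 q1 q2 k1.+1 k2.+1.
  + by rewrite -ea c2.
  + by [].
  + by [].
  + by rewrite -ea.
  rewrite e2; congr cons.
  have sb2 : word_shape w2 = Some b by rewrite sb' eb eb' e1 e2 e3.
  have [k3|k3] := leqP k1 2; last first.
    by apply: (IH b) => //; [move: c1 | move: c2]; rewrite ea eb !count_cat /=; lia.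
  apply: (twos_mf _ _ _ sb sb2 d'); first exact: shape_pos sb.
    move: c2; rewrite ea eb count_cat all_cat /= => c2'.
    by rewrite k3 !(@count0_all (ltn 2)) //; try (move=> x /=); lia.
  by move: c1; rewrite ea eb !count_cat /=; lia.
- have e2 : k2 = 1 by lia.
  by rewrite e2 in x2 s2 d; case: x2.
- have e1 : k1 = 1 by lia.
  by rewrite e1 in x1 s1 d; case: x1.
have e1 : k1 = 1 by lia.
have e2 : k2 = 1 by lia.
rewrite e1 e2; congr cons; rewrite e1 e2 in ea ea' eb eb'.
have c3 : count (pred1 2) a <= 1.
  have : count (pred1 2) a + count (ltn 2) a <= count (ltn 1) a.
    by elim: (a) => //= z s; lia.
  by lia.
have [||||f1 _ f3] := @split_unique (pred1 2) p1 p2 q1 q2 2 2.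
- by rewrite -ea.
- by [].
- by [].
- by rewrite -ea.
apply: (@hook_mf b) => //; last by rewrite sb' eb eb' f1 f3.
by move: c1; rewrite ea eb !count_cat /=; lia.
Qed.

(** In contrast to [word_split_at_one], the last cell of a row of length 3 in [b] may come after the
    separating row, as a letter 2 among those of [x]. At that moment [x] has no row of length 2 yet,
    so [d2] has no letter 1. *)
Lemma word_split_at_one3 w x b :
  all (geq 2) x -> count (ltn 2) b <= 1 -> all (geq 3) b ->
  word_shape w = Some (x ++ 1 :: b) ->
  (exists d u, [/\ w = d ++ 0 :: u, word_shape d = Some x & word_shape u = Some b])
  \/ (exists d1 d2 u b1 b2, [/\ w = (d1 ++ 2 :: d2) ++ 0 :: u,
        word_shape (d1 ++ d2) = Some x, 1 \notin d2, b = b1 ++ 3 :: b2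
      & word_shape u = Some (b1 ++ 2 :: b2)]).
Proof.
move=> + cb b3; elim: w x => [|k w IH] x x2; first by case: x {x2}.
case/shape_consP=> a sa [-> |a1 a2 k0 ka ea e].
  case: x x2 => [|y x] /= x2 [].
    by move=> e; left; exists [::], w; rewrite sa e.
  move=> -> ea; rewrite -ea in sa; case/andP: x2 => _ x2.
  case: (IH _ x2 sa) => [[d [u [-> sd su]]]|[d1 [d2 [u [b1 [b2 [-> sd n1 eb su]]]]]]].
    by left; exists (0 :: d), u; rewrite (shape_cons 0 sd).
  right; exists (0 :: d1), d2, u, b1, b2; split=> //.
  by rewrite cat_cons (shape_cons 0 sd).
have [[y2 ex eb]|[y2 ex eb]] : (exists2 y2, x = a1 ++ k.+1 :: y2 & a2 = y2 ++ 1 :: b)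
    \/ (exists2 y2, a1 = x ++ 1 :: y2 & b = y2 ++ k.+1 :: a2).
  elim: a1 x ka e {ea x2} => [|y a1 IHa] [|z x] //=.
  - by move=> _ [ek]; rewrite -ek in k0.
  - by move=> _ [-> <-]; left; exists x.
  - by move=> _ [-> ->]; right; exists a1.
  - rewrite inE negb_or => /andP[_ kn] [-> /(IHa _ kn)[][y2 -> ->]].
      by left; exists y2.
    by right; exists y2.
- have x2' : all (geq 2) (a1 ++ k :: y2).
    by move: x2; rewrite ex !all_cat /= => /and3P[-> /ltnW -> ->].
  have sa' : word_shape w = Some ((a1 ++ k :: y2) ++ 1 :: b).
    by rewrite sa ea eb -catA.
  case: (IH _ x2' sa') => [[d [u [-> sd su]]]|[d1 [d2 [u [b1 [b2 [-> sd n1 eb' su]]]]]]].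
    by left; exists (k :: d), u; rewrite (shape_cons k sd) add_cell_cat // ex.
  right; exists (k :: d1), d2, u, b1, b2; split=> //.
  by rewrite cat_cons (shape_cons k sd) add_cell_cat // ex.
have ek : k = 2.
  move: b3; rewrite eb all_cat /= => /and3P[_ k3 _].
  have : k != 1 by apply: contraNneq ka => ->; rewrite ex mem_cat mem_head orbT.
  by lia.
rewrite {}ek {k0} in ka ea e eb *.
have [d [u [-> sd su]]] : exists d u, [/\ w = d ++ 0 :: u,
    word_shape d = Some x & word_shape u = Some (y2 ++ 2 :: a2)].
  apply: word_split_at_one; last by rewrite sa ea ex -catA.
  move: cb; rewrite eb count_cat all_cat /= => cb.
  by rewrite !(@count0_all (ltn 2)) //; try (move=> z /=); lia.
(* The letter 2 reached past [x], so all rows of [x] have length 1 and all letters of [d] are 0. *)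
right; exists [::], d, u, y2, a2; split=> //.
apply/negP => d1; have x1 : all (geq 1) x.
  apply/allP => z zx; have /= := allP x2 _ zx.
  have : z != 2 by apply: contraNneq ka => <-; rewrite ex mem_cat zx.
  by lia.
by have := allP (letter_lt sd x1) _ d1.
Qed.

(** The bit after the separating 0 is true whatever follows, so a second 0 can stand for the
    rest. *)
Lemma des_cat_mid d z u : des (d ++ [:: 0, z & u]) = des (d ++ [:: 0; 0]) ++ des (z :: u).
Proof.
elim: d => [|x d IH] //.
have nc (v : seq nat) : d ++ 0 :: v != [::] by case: (d).
by rewrite !cat_cons !(des_cons x (nc _)) IH; case: (d).
Qed.

(* The words of shape (2^b), and those with one letter 2 inserted that has no
   letter 1 to its right: a row already of length 2 would receive the cell. *)
Definition tails (b : nat) : seq (seq nat) :=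
  words_of (nseq b 2) ++
  flatten [seq [seq take i d ++ 2 :: drop i d | i <- iota 0 (size d).+1
                & 1 \notin drop i d]
          | d <- words_of (nseq b 2)].

(** Members of [tails b] have length [2b] or [2b + 1]. In both cases the first [2b + 1] bits do not
    depend on what follows the separating 0, and they are distinct by computation. *)
Lemma tails_des_inj b d1 d2 u1 u2 :
  b <= 2 -> d1 \in tails b -> d2 \in tails b -> u1 != [::] -> u2 != [::] ->
  des (d1 ++ 0 :: u1) = des (d2 ++ 0 :: u2) -> d1 = d2.
Proof.
move=> b2 h1 h2; case: u1 u2 => [|z1 u1] [|z2 u2] // _ _.
have bc : b = 0 \/ b = 1 \/ b = 2 by lia.
rewrite (des_cat_mid d1) (des_cat_mid d2) => /(f_equal (take b.*2.+1)).
have sz d : d \in tails b -> b.*2.+1 <= size (des (d ++ [:: 0; 0])).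
  have : all (fun d => b.*2.+1 <= size (des (d ++ [:: 0; 0]))) (tails b).
    by move: bc => [->|[->|->]]; vm_compute.
  by move/allP; apply.
rewrite !takel_cat ?sz // => e.
have : uniq [seq take b.*2.+1 (des (d ++ [:: 0; 0])) | d <- tails b].
  by move: bc => [->|[->|->]]; vm_compute.
elim: (tails b) h1 h2 => //= d s IH; rewrite !inE.
move=> /predU1P[e1|m1] /predU1P[e2|m2] /andP[/negP n u]; last exact: IH.
- by rewrite e1 e2.
- by case: n; apply/mapP; exists d2; rewrite // -e -e1.
- by case: n; apply/mapP; exists d1; rewrite // e -e2.
Qed.

Lemma short_mf a :
  all (mem [:: 2; 3]) a -> size a <= 3 -> count (ltn 2) a <= 1 -> words_mf a.
Proof.
move=> h s c; apply: mf_checkP; move: h s c.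
case: a => [|y [|z [|v [|? ?]]]] h s; last by [].
- by vm_compute.
- by move: h; rewrite /= !inE andbT => /orP[]/eqP->; vm_compute.
- by move: h; rewrite /= !inE andbT => /andP[] /orP[]/eqP-> /orP[]/eqP->; vm_compute.
move: h; rewrite /= !inE andbT => /and3P[].
by move=> /orP[]/eqP-> /orP[]/eqP-> /orP[]/eqP->; vm_compute.
Qed.

(** Split at the first 1. If a part 3 is left of it, the factors are independent. Otherwise the left
    factor has at most two parts, all equal to 2, and [tails_des_inj] recovers its letters together
    with a letter 2 that may have crossed. *)
Lemma threes_mf a :
  all (ltn 0) a -> all (geq 3) a -> count (ltn 2) a <= 1 ->
  count (ltn 1) a <= 3 -> words_mf a.
Proof.
move: {2}(size a).+1 (ltnSn (size a)) => n.
elim: n a => // n IH a; rewrite ltnS => sa a0 a3 c2 c1.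
have [c20|c21] := posnP (count (ltn 2) a).
  apply: twos_mf => //; last by lia.
  by apply: count0_all c20 => x /=; lia.
have [/first_one[x [b [ea x1]]]|n1] := boolP (1 \in a); last first.
  have h23 : all (mem [:: 2; 3]) a.
    apply/allP => x xa; have := allP a0 _ xa; have := allP a3 _ xa.
    by have : x != 1 by [apply: contra n1 => /eqP<-]; rewrite !inE /=; lia.
  have ss : size a <= 3.
    move: c1; rewrite (eq_in_count (a2 := predT)) ?count_predT // => y.
    by move/(allP h23); rewrite !inE /=; lia.
  exact: short_mf.
move: sa a0 a3 c2 c1 c21; rewrite ea size_cat /= !all_cat !count_cat /=.
move=> sa /andP[x0 b0] /andP[x3 b3] c2 c1 c21.
have [cx|cx] := posnP (count (ltn 2) x); last first.
  have b2 : all (geq 2) b by apply: (@count0_all (ltn 2)) => [y|] /=; lia.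
  by apply: words_mf_cat => //; [apply: IH | apply: twos_mf] => //; lia.
have x2 : all (geq 2) x by apply: count0_all cx => y /=; lia.
have ex : x = nseq (size x) 2.
  apply/all_pred1P/allP => y yx; have := allP x0 _ yx.
  have := allP x2 _ yx; by rewrite /=; have : y != 1 by [apply: contra x1 => /eqP<-]; lia.
(* Of the at most three parts above 1, one is the 3 in [b]. *)
have sx : size x <= 2.
  have : 0 < count (ltn 1) b.
    by apply: leq_trans (sub_count (a1 := ltn 2) _ b) => [|y /=]; lia.
  by move: c1; rewrite {1}ex count_nseq /=; lia.
have cb : count (ltn 2) b <= 1 by lia.
have cb1 : 0 < count (ltn 2) b by lia.
have tail w : word_shape w = Some (x ++ 1 :: b) -> exists d u, [/\
    w = d ++ 0 :: u, d \in tails (size x), u != [::]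
  & (2 \notin d /\ word_shape u = Some b) \/ (2 \in d /\ exists b1 b2,
      b = b1 ++ 3 :: b2 /\ word_shape u = Some (b1 ++ 2 :: b2))].
  case/(word_split_at_one3 x2 cb b3)
    => [[d [u [-> sd su]]]|[d1 [d2 [u [b1 [b2 [-> sd n1 eb su]]]]]]].
    exists d, u; split=> //; last 1 first.
    - left; split=> //; apply/negP => d2; by have := allP (letter_lt sd x2) _ d2.
    - by rewrite mem_cat -ex mem_words_of.
    - exact: nonempty_of_count su cb1.
  exists (d1 ++ 2 :: d2), u; split=> //.
  - rewrite mem_cat; apply/orP; right; apply/flatten_mapP.
    exists (d1 ++ d2); first by rewrite -ex mem_words_of.
    apply/mapP; exists (size d1); last by rewrite take_size_cat // drop_size_cat.
    by rewrite mem_filter drop_size_cat // n1 mem_iota size_cat; lia.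
  - by apply: (nonempty_of_count (p := ltn 1) su); rewrite count_cat /=; lia.
  - by right; rewrite mem_cat mem_head orbT; split=> //; exists b1, b2.
move=> w1 w2 /[dup] s1 /tail[d1 [u1 [e1 t1 n1 h1]]].
move=> /[dup] s2 /tail[d2 [u2 [e2 t2 n2 h2]]]; rewrite e1 e2 => d.
have ed := tails_des_inj sx t1 t2 n1 n2 d; rewrite -{}ed {t1 t2} in d h2 e2 *.
have su : size u1 = size u2.
  have := size_shape s1; rewrite -(size_shape s2) e1 e2 !size_cat /=; lia.
have [_ du] := des_cat0 erefl d su.
congr (_ ++ _ :: _).
(* The common left factor contains 2 exactly if a crossing took place, so both words are in the same
   case. *)
case: h1 h2 => [[/negPf m1 su1]|[m1 [b1 [b2 [eb su1]]]]]; rewrite m1 => -[] [] //.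
  by move=> _ su2; apply: (IH b) => //; lia.
move=> _ [b1' [b2' [eb' su2]]].
have [||||f1 _ f2] := @split_unique (ltn 2) b1 b2 b1' b2' 3 3 => //.
- by rewrite -eb.
- by rewrite -eb.
rewrite -f1 -f2 in su2; apply: (twos_mf _ _ _ su1 su2 du); first exact: shape_pos su1.
  move: cb; rewrite eb count_cat all_cat /= => cb'.
  by rewrite !(@count0_all (ltn 2)) //; try (move=> z /=); lia.
by move: c1; rewrite eb !count_cat /=; lia.
Qed.

(** * Failure of multiplicity freeness *)

Definition clash (a : seq nat) : Prop :=
  exists w1 w2, [/\ word_shape w1 = Some a, word_shape w2 = Some a, des w1 = des w2
                  & w1 != w2].

Lemma clash_not_mf a : clash a -> ~ words_mf a.
Proof. by move=> [w1 [w2 [s1 s2 d /eqP n]]] /(_ _ _ s1 s2 d). Qed.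

(* The appended cell is compared with the last cell of either word in the same
   way: column 0 always creates a descent, a new last column never does. *)
Lemma clash_grow a b v k :
  clash a -> k = 0 \/ all (geq k) a -> grow (rcons v k) (Some a) = Some b ->
  clash b.
Proof.
move=> [w1 [w2 [s1 s2 d n]]] hk g.
exists (v ++ k :: w1), (v ++ k :: w2).
have sh w : word_shape w = Some a -> word_shape (v ++ k :: w) = Some b.
  by move=> s; rewrite -cat_rcons /word_shape grow_cat -/(word_shape w) s.
split; rewrite ?sh //; last first.
  by apply: contra n => /eqP /(f_equal (drop (size v))); rewrite !drop_size_cat // => -[->].
have sz : size w1 = size w2 by rewrite (size_shape s1) (size_shape s2).
apply: des_catl => //; first by case: (w1) (w2) sz => [|? ?] [].
case: hk => [->//|ka].
have := letter_lt s1 ka; have := letter_lt s2 ka.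
by case: (w1) (w2) sz => [|x1 v1] [|x2 v2] //= _ /andP[? _] /andP[? _]; lia.
Qed.

Definition reach (a b : seq nat) : Prop := exists v, grow v (Some a) = Some b.

Lemma reach_refl a : reach a a. Proof. by exists [::]. Qed.

Lemma reach_trans a b c : reach a b -> reach b c -> reach a c.
Proof.
by move=> [v gv] [u gu]; exists (u ++ v); rewrite grow_cat gv.
Qed.

(** The leftmost rule decides which row grows, but does not affect the multiset of lengths. *)
Lemma add_cell_perm k a s :
  0 < k -> perm_eq a (k :: s) ->
  exists2 b, add_cell k a = Some b & perm_eq b (k.+1 :: s).
Proof.
move=> k0 p; have ka : k \in a by rewrite (perm_mem p) mem_head.
have e : add_cell k a = Some (incr_nth a (index k a)).
  by case: (k) k0 ka => // k' _; rewrite /add_cell => ->.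
exists (incr_nth a (index k a)) => //.
case/add_cellP: e => [k00|b1 b2 _ _ ea ->]; first by rewrite k00 in k0.
move: p; rewrite ea (perm_catCA b1 [:: k] b2) perm_cons.
by rewrite (perm_catCA b1 [:: k.+1] b2) perm_cons.
Qed.

Lemma reach_incr x y a s :
  0 < x <= y -> perm_eq a (x :: s) ->
  exists2 b, reach a b & perm_eq b (y :: s).
Proof.
case/andP=> x0 xy; rewrite -(subnKC xy); elim: (y - x) => [|d IH] p.
  by rewrite addn0; exists a => //; exact: reach_refl.
have [b ab pb] := IH p; have xd : 0 < x + d by lia.
have [c ac pc] := add_cell_perm xd pb; exists c; last by rewrite addnS.
by apply: reach_trans ab _; exists [:: x + d]; rewrite /grow /= ac.
Qed.

(** Rows are treated one at a time and then moved to [s]; a row missing in [l] is opened with length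
    1 and extended. *)
Lemma reach_contain (l m a s : seq nat) :
  size l <= size m -> all (ltn 0) l -> all (ltn 0) m ->
  (forall i, i < size l -> nth 0 l i <= nth 0 m i) ->
  perm_eq a (l ++ s) -> exists2 b, reach a b & perm_eq b (m ++ s).
Proof.
elim: m l a s => [|y m IH] [|x l] a s //=.
- by move=> *; exists a => //; exact: reach_refl.
- move=> _ _ /andP[y0 m0] _ pa.
  have p1 : perm_eq (1 :: a) (1 :: s) by rewrite perm_cons.
  have [b ab pb] := reach_incr (x := 1) (y := y) y0 p1.
  have [//|//|//|//|//|c bc pc] := IH [::] b (y :: s).
  exists c; last by rewrite (permPl pc) (perm_catCA m [:: y] s).
  apply: reach_trans bc; apply: reach_trans ab; by exists [:: 0].
- move=> slm /andP[x0 l0] /andP[y0 m0] h pa.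
  have xy : 0 < x <= y by rewrite x0 (h 0).
  have [b ab pb] := reach_incr xy pa.
  have [//|//|//|||c bc pc] := IH l b (y :: s).
  + by move=> i il; apply: (h i.+1).
  + by rewrite (permPl pb) perm_sym (perm_catCA l [:: y] s).
  exists c; last by rewrite (permPl pc) (perm_catCA m [:: y] s).
  exact: reach_trans bc.
Qed.

(** [clash_grow] restricts only the first added cell: it opens a row if [m] has more parts, and
    extends a longest row otherwise. *)
Lemma clash_contain (l m a : seq nat) :
  clash a -> perm_eq a l -> sorted geq l -> all (ltn 0) l -> all (ltn 0) m ->
  size l <= size m -> (forall i, i < size l -> nth 0 l i <= nth 0 m i) ->
  (head 0 l < head 0 m) || (size l < size m) ->
  exists2 b, perm_eq b m & clash b.
Proof.
move=> ca pa sl l0 m0 slm h hh.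
suff [k [a' [hk aa' [b [v gv] pb]]]] : exists k a',
    [/\ k = 0 \/ all (geq k) a, add_cell k a = Some a'
      & exists2 b, reach a' b & perm_eq b m].
  exists b => //; apply: (clash_grow (v := v) ca hk).
  by rewrite -cats1 grow_cat /= aa'.
have [lt|/negPf lt] := boolP (size l < size m).
  exists 0, (1 :: a); split; [by left | by [] |].
  have [|||||b ab pb] := @reach_contain (rcons l 1) m (1 :: a) [::].
  + by rewrite size_rcons.
  + by rewrite all_rcons.
  + by [].
  + move=> i; rewrite size_rcons ltnS nth_rcons => il.
    case: ltngtP il => // [/h //|-> _].
    by move/(all_nthP 0): m0; apply.
  + by rewrite cats0 perm_sym perm_rcons perm_cons perm_sym.
  by exists b; rewrite // cats0 in pb.
rewrite lt orbF in hh; case: l m => [|x l] [|y m] // in pa sl l0 m0 slm h lt hh *.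
move: l0 m0 => /= /andP[x0 l0] /andP[y0 m0].
have [a' aa' pa'] := add_cell_perm x0 pa.
exists x, a'; split=> //.
  right; rewrite (perm_all _ pa) /= leqnn /=.
  by have /= := sl; rewrite (path_sortedE (rev_trans leq_trans)) => /andP[].
have [//|//|||| b ab pb] := @reach_contain (x.+1 :: l) (y :: m) a' [::].
+ by rewrite /= y0.
+ by case=> [|i] //= il; apply: (h i.+1).
+ by rewrite cats0.
by exists b; rewrite // cats0 in pb.
Qed.

(** The list has to include, for instance, [[:: 5; 4]]: it contains [[:: 5; 3]], but has neither a
    longer first row nor more rows. *)
Definition clash_bases : seq (seq nat) :=
  [:: [:: 5; 3]; [:: 5; 4]; [:: 5; 5]; [:: 3; 3; 1]; [:: 3; 3; 2]; [:: 3; 3; 3];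
      [:: 4; 2; 2]; [:: 2; 2; 2; 2; 2]; [:: 3; 2; 2; 2]].

(** The two words are explicit; their shape is a rearrangement of [l], not always [l] itself. *)
Lemma clash_base l :
  l \in clash_bases -> exists2 b, perm_eq b l & clash b.
Proof.
have H (a w1 w2 : seq nat) : perm_eq a l -> word_shape w1 == Some a ->
    word_shape w2 == Some a -> des w1 == des w2 -> w1 != w2 ->
    exists2 b, perm_eq b l & clash b.
  by move=> pa /eqP s1 /eqP s2 /eqP d n; exists a => //; exists w1, w2; split.
rewrite !inE => h; repeat case/predU1P: h => [e|h]; first 1 last.
all: try move/eqP: h => e; subst l.
- by apply: (H [:: 5; 4] [:: 4; 3; 3; 2; 1; 2; 1; 0; 0]
                  [:: 3; 2; 4; 3; 1; 2; 1; 0; 0]).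
- by apply: (H [:: 5; 5] [:: 4; 3; 4; 3; 2; 2; 1; 0; 1; 0]
                  [:: 4; 3; 4; 2; 1; 3; 2; 0; 1; 0]).
- by apply: (H [:: 1; 3; 3] [:: 2; 2; 0; 1; 0; 1; 0]
                  [:: 0; 2; 1; 2; 0; 1; 0]).
- by apply: (H [:: 3; 3; 2] [:: 2; 2; 1; 1; 0; 1; 0; 0]
                  [:: 1; 2; 1; 2; 0; 1; 0; 0]).
- by apply: (H [:: 3; 3; 3] [:: 2; 1; 2; 1; 2; 0; 1; 0; 0]
                  [:: 2; 1; 2; 0; 2; 1; 1; 0; 0]).
- by apply: (H [:: 2; 4; 2] [:: 1; 3; 1; 2; 0; 1; 0; 0]
                  [:: 1; 3; 0; 2; 1; 1; 0; 0]).
- by apply: (H [:: 2; 2; 2; 2; 2] [:: 1; 1; 0; 1; 1; 0; 0; 1; 0; 0]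
                  [:: 1; 1; 0; 0; 1; 0; 1; 1; 0; 0]).
- by apply: (H [:: 2; 2; 3; 2] [:: 1; 1; 0; 1; 2; 0; 1; 0; 0]
                  [:: 1; 1; 0; 0; 2; 1; 1; 0; 0]).
by apply: (H [:: 3; 5] [:: 4; 2; 3; 1; 0; 2; 1; 0] [:: 2; 1; 4; 3; 0; 2; 1; 0]).
Qed.

Lemma clash_above_base (l m : seq nat) :
  l \in clash_bases -> all (ltn 0) m -> size l <= size m ->
  (forall i, i < size l -> nth 0 l i <= nth 0 m i) ->
  (head 0 l < head 0 m) || (size l < size m) ->
  exists2 b, perm_eq b m & clash b.
Proof.
move=> lb; have [a pa ca] := clash_base lb.
have /andP[sl pl] : sorted geq l && all (ltn 0) l.
  by move: l lb {pa}; apply/allP.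
exact: clash_contain ca pa sl pl.
Qed.

(** * Classification of the partitions *)

Definition listed (n : nat) (l : seq nat) : Prop :=
  (exists2 k, 0 <= k <= n - 1 & l = (n - k) :: nseq k 1) \/
  (exists2 k, 5 <= n /\ 0 <= k <= n - 5 & l = [:: n - 2 - k, 2 & nseq k 1]) \/
  (exists2 a, 2 <= a <= 4 /\ 2 * a <= n
            & l = nseq a 2 ++ nseq (n - 2 * a) 1) \/
  (7 <= n /\ l = [:: 3, 2, 2 & nseq (n - 7) 1]) \/
  (l = [:: 3; 3] \/ l = [:: 4; 3] \/ l = [:: 4; 4]).

Lemma partition_ones l :
  all (ltn 0) l -> sorted geq l -> head 0 l <= 1 -> l = nseq (size l) 1.
Proof.
move=> p s h; apply/all_pred1P/allP => x xl.
have /allP/(_ _ xl)/= x0 := p.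
suff : x <= 1 by rewrite /=; lia.
case: l s h xl {p} => // y l /=; rewrite (path_sortedE (rev_trans leq_trans)).
move=> /andP[/allP yl _] y1; rewrite inE => /predU1P[->//|/yl /=]; lia.
Qed.

Lemma partition_twos l :
  all (ltn 0) l -> sorted geq l -> head 0 l <= 2 ->
  exists a b, l = nseq a 2 ++ nseq b 1.
Proof.
elim: l => [|x l IH] /=; first by exists 0, 0.
move=> /andP[x0 p] s x2; have [e|n2] := eqVneq x 2.
  have [||| a [b ->]] := IH => //; first exact: path_sorted s.
    by move: s; rewrite e; case: (l) => //= y l' /andP[].
  by exists a.+1, b; rewrite e.
by exists 0, (size l).+1; apply: (@partition_ones (x :: l)); rewrite //= ?x0 //; lia.
Qed.

(** The cases follow the second part [y]. For [y = 2] the third part is examined, then the first,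
    then the fourth part or the number of 2s. *)
Lemma listed_or_clash n l :
  is_partition_of n l -> 0 < n ->
  listed n l \/ exists2 b, perm_eq b l & clash b.
Proof.
move=> /and3P[pos srt /eqP sn] n0.
case: l => [|x [|y s]] in pos srt sn *; first by rewrite -sn in n0.
  by left; left; exists 0 => //; rewrite -sn /=; congr cons; lia.
have {}pos : all (ltn 0) [:: x, y & s] by [].
have /= /andP[x0 pys] := pos; have /= /andP[xy ys] := srt.
have {}xy : y <= x by [].
have [y1|y2] := leqP y 1.
  have := @partition_ones (y :: s) pys ys y1 => -[e1 e2]; left; left.
  have ss : sumn s = size s by rewrite e2 sumn_nseq size_nseq mul1n.
  exists (size s).+1; rewrite -sn /= e1 ss; first by lia.
  by rewrite /= -e2; congr cons; lia.
have [y3|y3] := leqP y 2; last first.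
  case: s => [|z s] in sn ys pys pos srt *.
    have [x5|x6] := leqP x 5; last first.
      by right; apply: (@clash_above_base [:: 5; 3]) => //=; [case=> [|[|i]] //=|]; lia.
    (* From [3 <= y <= x <= 5] six pairs remain: three listed ones and three bases. *)
    have : [:: x; y] \in [:: [:: 3; 3]; [:: 4; 3]; [:: 4; 4]] ++ clash_bases.
      by rewrite mem_cat !inE !eqseq_cons !eqxx /= ?andbF ?andbT; lia.
    rewrite mem_cat => /orP[h|]; last by right; apply: clash_base.
    left; do 4 right; move: h; rewrite !inE => /or3P[]/eqP->; tauto.
  have /= /andP[yz _] := ys; have /= /and3P[_ z0 _] := pys.
  have {}yz : z <= y by [].
  (* In the second case the partition is [[:: 3; 3; z]] with [z] at most 3, itself a base. *)
  have [big|small] := boolP ((3 < x) || (s != [::])).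
    right; apply: (@clash_above_base [:: 3; 3; 1]) => //=.
      by case=> [|[|[|i]]] //=; lia.
    by case: (s) big => //=; lia.
  have /eqP es : s == [::] by move: small; case: (s) => //=; lia.
  right; apply: clash_base; rewrite es !inE !eqseq_cons !eqxx /= ?andbF ?andbT.
  by move: small; rewrite es /=; lia.
have {y2 y3} ey : y = 2 by lia.
rewrite {}ey in pos srt sn ys pys xy *.
have [h1|h2] := leqP (head 0 s) 1.
  have es : s = nseq (size s) 1.
    by apply: partition_ones _ (path_sorted ys) h1; case/andP: pys.
  have ss : sumn s = size s by rewrite es sumn_nseq size_nseq mul1n.
  have [x3|x3] := leqP 3 x.
    left; right; left; exists (size s); rewrite -sn /= ss; first by lia.
    by rewrite -es; congr cons; lia.
  have ex : x = 2 by lia.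
  left; do 2 right; left; exists 2; rewrite -sn /= ss ex; first by lia.
  by rewrite /= {1}es; congr [:: _, _ & nseq _ _]; lia.
case: s => [|z s] // in sn ys pys pos srt h2 *.
have /= /andP[yz zs] := ys; have /= /andP[z0 ps] := pys.
have ez : z = 2 by move: h2 yz; rewrite /geq /=; lia.
rewrite {}ez {h2 yz z0} in pos srt sn ys pys zs *.
have [x4|x4] := leqP 4 x.
  have [/eqP e|big] := boolP ([:: x, 2, 2 & s] == [:: 4; 2; 2]).
    by rewrite e; right; apply: clash_base.
  right; apply: (@clash_above_base [:: 4; 2; 2]) => //=.
    by case=> [|[|[|i]]] //=; lia.
  move: big; rewrite !eqseq_cons !eqxx /=.
  by case: (s) => [|u t] /=; rewrite ?eqxx ?andbT; lia.
have [x3|x3] := eqVneq x 3.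
  rewrite {}x3 {xy x4} in pos srt sn *.
  have [h1|h2] := leqP (head 0 s) 1.
    have es : s = nseq (size s) 1.
      exact: partition_ones ps (path_sorted zs) h1.
    have ss : sumn s = size s by rewrite es sumn_nseq size_nseq mul1n.
    left; do 3 right; left; rewrite -sn /= ss; split; first by lia.
    by rewrite {1}es; congr [:: _, _, _ & nseq _ _]; lia.
  case: s => [|u s] // in sn ys pys pos srt h2 zs ps *.
  have eu : u = 2 by have /= := zs; move: h2; rewrite /geq /=; lia.
  rewrite {}eu {srt sn ys pys h2 zs ps} in pos *.
  case: s => [|v s] in pos *; first by right; apply: clash_base.
  by right; apply: (@clash_above_base [:: 3; 2; 2; 2]) => //=;
    case=> [|[|[|[|i]]]] //=; lia.
have ex : x = 2 by lia.
rewrite {}ex {xy x3 x4} in pos srt sn *.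
have [a [b e]] : exists a b, [:: 2, 2, 2 & s] = nseq a 2 ++ nseq b 1.
  exact: partition_twos.
have a3 : 2 < a by have := f_equal (count_mem 2) e; rewrite count_cat !count_nseq /=; lia.
rewrite {}e in pos sn *.
have en : n = 2 * a + b by rewrite -sn sumn_cat !sumn_nseq; lia.
have [a4|a5] := leqP a 4.
  left; do 2 right; left; exists a; last by rewrite en addKn.
  by rewrite en; lia.
have [ab5|ab6] := leqP (a + b) 5.
  have [-> ->] : a = 5 /\ b = 0 by lia.
  by right; apply: clash_base.
right; apply: (@clash_above_base [:: 2; 2; 2; 2; 2]) => //=.
- by rewrite size_cat !size_nseq; lia.
- move=> i i5; rewrite nth_cat size_nseq nth_nseq.
  have -> : i < a by lia.
  by case: i i5 => [|[|[|[|[|i]]]]].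
- by rewrite size_cat !size_nseq ab6 orbT.
Qed.

(** * Standard composition tableaux as words *)

Fixpoint word_chain (w : seq nat) : seq (seq nat) :=
  odflt [::] (word_shape w) :: if w is _ :: w' then word_chain w' else [::].

Lemma word_chain_cons k w :
  word_chain (k :: w) = odflt [::] (word_shape (k :: w)) :: word_chain w.
Proof. by []. Qed.

Lemma word_chainE w a :
  word_shape w = Some a -> word_chain w = a :: behead (word_chain w).
Proof. by case: w => [[<-]|k w /= ->]. Qed.

(** Parts must be positive because [up_covers] would extend a part 0, whereas the letter 0 opens a
    row. *)
Lemma covered_byP b c :
  all (ltn 0) b -> covered_by b c <-> exists k, add_cell k b = Some c.
Proof.
move=> b0; rewrite /covered_by inE; split.
  case/predU1P=> [->|/mapP[k]]; first by exists 0.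
  rewrite mem_undup => kb ->; exists k.
  by have := allP b0 _ kb; case: (k) kb => // k' kb _; rewrite /add_cell kb.
case=> -[[<-]|k]; first by rewrite eqxx.
rewrite /add_cell; case: ifP => // kb [<-]; apply/orP; right.
by apply/mapP; exists k.+1; rewrite ?mem_undup.
Qed.

Lemma word_chainP a c :
  is_chain a c <-> exists2 w, word_shape w = Some a & c = word_chain w.
Proof.
split=> [/and4P[]|[w]].
  case: c => // x c _ /= /eqP -> {x}.
  elim: c a => [|y c IH] a /=; first by move=> /eqP-> _; exists [::].
  move=> l /andP[ya s]; have [w sw e] := IH _ l s.
  have [k ak] := (covered_byP _ (shape_pos sw)).1 ya.
  have sk : word_shape (k :: w) = Some a by rewrite (shape_cons k sw).
  by exists (k :: w); rewrite // word_chain_cons sk -e.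
move=> sw ->; rewrite /is_chain (word_chainE sw) /= eqxx /=.
elim: w a sw => [|k w IH] a; first by case=> <-.
move=> sk; have [b eb _] := shape_consP sk.
rewrite word_chain_cons (word_chainE eb) /=; have /andP[-> ->] := IH _ eb.
rewrite !andbT; apply/(covered_byP _ (shape_pos eb)).
by exists k; rewrite -(shape_cons k eb).
Qed.

Lemma find_map_eq (p q : pred (seq nat)) s t :
  map p s = map q t -> find p s = find q t.
Proof.
have e (r : pred (seq nat)) u : find r u = find id (map r u).
  by elim: u => //= x u ->.
by rewrite (e p) (e q) => ->.
Qed.

Lemma find_zip_incr b1 b2 k :
  find (fun p => p.1 != p.2) (zip (b1 ++ k :: b2) (b1 ++ k.+1 :: b2)) = size b1.
Proof.
elim: b1 => [|x b1 /= ->] /=; last by rewrite eqxx.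
by have -> : k != k.+1 by lia.
Qed.

Lemma add_entryE i b a k (T : tableau) :
  add_cell_spec k b a -> map size T = b ->
  map size (add_entry i b a T) = a /\
  ((k = 0 /\ add_entry i b a T = [:: i] :: T) \/
   exists T1 r T2, [/\ size r = k, T = T1 ++ r :: T2
                     & add_entry i b a T = T1 ++ rcons r i :: T2]).
Proof.
case=> [-> ->|b1 b2 k0 kb eb ea] sT.
  by rewrite /add_entry eqxx /= sT; split=> //; left.
have sr : size b1 < size T.
  by rewrite -(size_map size) sT eb size_cat /=; lia.
set r := nth [::] T (size b1).
have eT : T = take (size b1) T ++ r :: drop (size b1).+1 T.
  by rewrite -drop_nth // cat_take_drop.
have sk : size r = k.
  by rewrite /r -(nth_map _ 0) // sT eb nth_cat ltnn subnn.
have ee : add_entry i b a T =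
    take (size b1) T ++ rcons r i :: drop (size b1).+1 T.
  rewrite /add_entry; have -> : (a == 1 :: b) = false.
    by apply/eqP => /(f_equal size); rewrite ea eb /= !size_cat /=; lia.
  by rewrite eb ea find_zip_incr -/r set_nthE sr.
split; last by right; exists (take (size b1) T), r, (drop (size b1).+1 T).
rewrite ee map_cat /= size_rcons sk map_take map_drop sT ea eb.
by rewrite take_size_cat // drop_cat ltnNge leqnSn subSnn /= drop0.
Qed.

Lemma column_cat_in (T1 T2 : tableau) r j :
  j \in r -> all (fun s => j \notin s) T1 -> column (T1 ++ r :: T2) j = index j r.
Proof.
move=> jr n1; rewrite /column find_cat.
have -> : has (fun s => j \in s) T1 = false.
  by apply/negP => /hasP[s /(allP n1)] /negP.
by rewrite /= jr addn0 nth_cat ltnn subnn.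
Qed.

(** The bound on the entries makes the new entry [i] fresh, so that inserting it keeps the columns
    of the others; [has] ensures that the search in [column] succeeds. *)
Lemma word_tableauP i w a :
  word_shape w = Some a ->
  [/\ map size (tableau_from i (word_chain w)) = a,
      forall r j, r \in tableau_from i (word_chain w) -> j \in r -> i <= j
    & forall j, j < size w ->
        has (fun r => i + j \in r) (tableau_from i (word_chain w)) /\
        column (tableau_from i (word_chain w)) (i + j) = nth 0 w j].
Proof.
elim: w a i => [|k w IH] a i; first by case=> <-.
move=> sk; have [b sb h] := shape_consP sk.
have -> : tableau_from i (word_chain (k :: w)) =
    add_entry i b a (tableau_from i.+1 (word_chain w)).
  by rewrite word_chain_cons sk (word_chainE sb).
have [sT] := IH _ i.+1 sb; move: (tableau_from _ _) sT => T sT Tgt col.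
have Ti r : r \in T -> i \notin r by move=> rT; apply/negP => /(Tgt _ _ rT); lia.
have [sA] := add_entryE i h sT.
case=> [[k0 eA]|[T1 [r [T2 [sr eT eA]]]]].
  rewrite {}eA in sA *; split=> //.
    move=> r j; rewrite inE => /predU1P[->|rT]; first by rewrite inE => /eqP->.
    by move/(Tgt _ _ rT)/ltnW.
  case=> [|j] jw; first by rewrite addn0 /= mem_head k0 /column /= mem_head /= eqxx.
  rewrite addnS -addSn; have [hj cj] := col j jw.
  have ne : (i.+1 + j == i) = false by lia.
  by rewrite /= hj orbT; split=> //; rewrite -cj /column /= inE ne.
split=> //; rewrite {}eA {sA}.
  move=> s j sT' js; have [e|n] := eqVneq j i; first by rewrite e.
  apply: ltnW; move: sT'; rewrite mem_cat inE => /or3P[m|/eqP es|m].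
  - by apply: (Tgt s); rewrite // eT mem_cat m.
  - apply: (Tgt r); first by rewrite eT mem_cat mem_head orbT.
    by move: js; rewrite es mem_rcons inE (negPf n).
  - by apply: (Tgt s); rewrite // eT mem_cat inE m !orbT.
have nr : i \notin r by apply: Ti; rewrite eT mem_cat mem_head orbT.
case=> [|j] jw.
  rewrite addn0; split.
    by rewrite has_cat /= mem_rcons mem_head orbT.
  rewrite column_cat_in ?mem_rcons ?mem_head //; last first.
    by apply/allP => s sT1; apply: Ti; rewrite eT mem_cat sT1.
  by rewrite -cats1 index_cat (negPf nr) /= eqxx addn0.
rewrite addnS -addSn; have [hj cj] := col j jw.
set J := i.+1 + j in hj cj *; have nJ : J != i by rewrite /J; lia.
(* Inserting [i] does not change which rows contain [J], so the search stops at the same row. *)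
have e : map (fun s => J \in s) (T1 ++ rcons r i :: T2) = map (fun s => J \in s) T.
  by rewrite eT !map_cat /= mem_rcons inE (negPf nJ).
have fe := find_map_eq e.
split.
  move: hj; rewrite !has_find fe eT !size_cat //.
rewrite [RHS]/= -cj /column fe; move: (find _ T) (nth_find [::] hj) => f.
rewrite eT !nth_cat; case: ifP => // _; case: (_ - _) => [|m] //= Jr.
by rewrite -cats1 index_cat Jr.
Qed.

Definition word_tableau (w : seq nat) : tableau := chain_tableau (word_chain w).

Lemma mem_SCTs_word a T :
  T \in SCTs a <-> exists2 w, word_shape w = Some a & T = word_tableau w.
Proof.
split=> [/mem_SCTs[c /word_chainP[w sw ->] ->]|[w sw ->]]; first by exists w.
by apply/mem_SCTs; exists (word_chain w) => //; apply/word_chainP; exists w.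
Qed.

Lemma word_tableau_column w a j :
  word_shape w = Some a -> j < size w -> column (word_tableau w) j.+1 = nth 0 w j.
Proof. by move=> /(word_tableauP 1)[_ _ h] /h[_]. Qed.

Lemma word_tableau_inj w1 w2 a :
  word_shape w1 = Some a -> word_shape w2 = Some a ->
  word_tableau w1 = word_tableau w2 -> w1 = w2.
Proof.
move=> s1 s2 e; have sz : size w1 = size w2 by rewrite (size_shape s1) (size_shape s2).
apply: (@eq_from_nth _ 0) => // i i1.
by rewrite -(word_tableau_column s1) // e (word_tableau_column s2) // -sz.
Qed.

Lemma desE w : des w = [seq nth 0 w i.-1 <= nth 0 w i | i <- iota 1 (size w).-1].
Proof.
case: w => // x w; apply: (@eq_from_nth _ false).
  by rewrite size_des size_map size_iota.
rewrite size_des /= => i iw.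
by rewrite (nth_pairmap 0) // (nth_map 0) ?size_iota // nth_iota.
Qed.

Lemma descents_word w a :
  word_shape w = Some a ->
  descents (sumn a) (word_tableau w) = mask (des w) (iota 1 (sumn a).-1).
Proof.
move=> s; rewrite /descents filter_mask desE -(size_shape s); congr mask.
apply/eq_in_map => i; rewrite mem_iota => /andP[i0 iw].
by case: i i0 iw => // i _ iw; rewrite !(word_tableau_column s) //; lia.
Qed.

Lemma path_descents n T : 0 < n -> path ltn 0 (rcons (descents n T) n).
Proof.
move=> n0; have sub : subseq (descents n T) (iota 1 n.-1) by exact: filter_subseq.
have pth : path ltn 0 (iota 1 n.-1) := iota_ltn_sorted 0 n.-1.+1.
rewrite rcons_path (subseq_path ltn_trans sub pth) /=.
have := mem_last 0 (descents n T); rewrite inE => /predU1P[->//|].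
by move/(mem_subseq sub); rewrite mem_iota add1n prednK // => /andP[].
Qed.

Lemma mask_inj (T : eqType) (s : seq T) m1 m2 :
  uniq s -> size m1 = size s -> size m2 = size s ->
  mask m1 s = mask m2 s -> m1 = m2.
Proof.
elim: s m1 m2 => [|x s IH] [|b1 m1] [|b2 m2] //= /andP[xs us] [s1] [s2].
have nx m : x \in mask m s = false by apply: contraNF xs => /mem_mask.
case: b1 b2 => [] [] /= => [[]|e|e|]; try by move/(IH _ _ us s1 s2) ->.
- by have := nx m2; rewrite -e mem_head.
- by have := nx m1; rewrite e mem_head.
Qed.

(** A tableau amounts to its column word, and its composition to the descent set, hence to the bits
    of [des]. *)
Lemma com_inj_words a :
  {in SCTs a &, injective (com (sumn a))} <-> words_mf a.
Proof.
split=> [inj w1 w2 s1 s2 d|mf T1 T2].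
  apply: (word_tableau_inj s1 s2); apply: inj.
  - by apply/mem_SCTs_word; exists w1.
  - by apply/mem_SCTs_word; exists w2.
  by rewrite /com (descents_word s1) (descents_word s2) d.
move=> /mem_SCTs_word[w1 s1 ->] /mem_SCTs_word[w2 s2 ->].
have [n0|n0] := posnP (sumn a).
  move: (size_shape s1) (size_shape s2); rewrite n0.
  by case: (w1) (w2) => [|? ?] [].
move=> e; congr word_tableau; apply: (mf _ _ s1 s2).
have := f_equal comp_set e; rewrite /com.
have [_ _ ->] := comp_setK (path_descents (word_tableau w1) n0).
have [_ _ ->] := comp_setK (path_descents (word_tableau w2) n0).
rewrite (descents_word s1) (descents_word s2).
apply: mask_inj; rewrite ?iota_uniq ?size_des ?size_iota //.
- by rewrite (size_shape s1).
- by rewrite (size_shape s2).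
Qed.

Lemma com_comp a T : is_comp (com (sumn a) T) /\ sumn (com (sumn a) T) = sumn a.
Proof.
have [n0|n0] := posnP (sumn a); first by rewrite /com n0.
by have [] := comp_setK (path_descents T n0).
Qed.

(** * Linear independence of the fundamental functions *)

Lemma comp_set_cons x b :
  comp_set (x :: b) = if b is [::] then [::] else x :: map (addn x) (comp_set b).
Proof.
case: b => // y b; rewrite /comp_set /= addn0; congr cons.
by rewrite (iotaDl 1 1) -!map_comp.
Qed.

Lemma comp_set_bounds b j : is_comp b -> j \in comp_set b -> 0 < j < sumn b.
Proof.
elim: b j => // x b IH j /= /andP[x0 b0]; rewrite comp_set_cons.
case: b b0 IH => // y b b0 IH; rewrite inE => /predU1P[->|/mapP[i /(IH _ b0) h ->]].
  by have /= /andP[] := b0; lia.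
by lia.
Qed.

Lemma comp_set_sorted b : is_comp b -> sorted ltn (comp_set b).
Proof.
elim: b => // x b IH /= /andP[x0 b0]; rewrite comp_set_cons.
case: b b0 IH => // y b b0 IH; rewrite /= (path_sortedE ltn_trans); apply/andP; split.
  apply/allP => j /mapP[i /(comp_set_bounds b0) h ->]; lia.
rewrite sorted_map; apply: sub_sorted (IH b0) => i j /=; lia.
Qed.

Lemma comp_set_inj b c :
  is_comp b -> is_comp c -> sumn b = sumn c -> comp_set b = comp_set c -> b = c.
Proof.
elim: b c => [|x b IH] [|y c] //=.
- by move=> _ /andP[y0 _]; lia.
- by move=> /andP[x0 _]; lia.
move=> /andP[x0 b0] /andP[y0 c0] e; rewrite !comp_set_cons.
case: b c b0 c0 e IH => [|u b] [|v c] //.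
  by move=> _ _ /= e _ _; congr [:: _]; lia.
move=> b0 c0 /= e IH [exy]; rewrite exy in e *.
move/(inj_map (@addnI y))/IH => -> //; by move: e => /=; lia.
Qed.

(** A weakly increasing word that rises at exactly the positions in [D]; its monomial detects the
    compositions whose set lies in [D]. *)
Definition test_word (n : nat) (D : seq nat) : seq nat :=
  [seq count (geq i) D | i <- iota 0 n].

Lemma test_word_sorted n D : sorted leq (test_word n D).
Proof.
rewrite sorted_map; apply: sub_sorted (iota_sorted 0 n) => i j ij /=.
by apply: sub_count => k /=; lia.
Qed.

Lemma F_word_test b D :
  is_comp b -> F_word b (test_word (sumn b) D) = all (mem D) (comp_set b).
Proof.
move=> cb; rewrite /F_word test_word_sorted /=; apply: eq_in_all => j.
move/(comp_set_bounds cb) => /andP[j0 jn].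
rewrite !(nth_map 0) ?size_iota ?nth_iota ?add0n //; try by lia.
have -> : count (geq j) D = count (geq j.-1) D + count_mem j D.
  by elim: D => //= x s ->; lia.
by rewrite -[X in X < _]addn0 ltn_add2l -has_count has_pred1.
Qed.

Lemma fundF_size b (s : seq nat) : sumn b != size s -> fundF b (seq_mset s) = 0%R.
Proof.
move=> n; rewrite /fundF; congr Posz; apply/eqP; rewrite cards_eq0.
apply/eqP/setP => t; rewrite !inE; apply/negP => /andP[_ /eqP/eq_seq_msetP/perm_size].
by rewrite size_map size_tuple => e; rewrite e eqxx in n.
Qed.

Lemma fundF_test b n D :
  is_comp b -> fundF b (seq_mset (test_word n D)) =
  ((sumn b == n) && all (mem D) (comp_set b))%:Z%R.
Proof.
move=> cb; have st : size (test_word n D) = n by rewrite size_map size_iota.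
have [e|ne] := eqVneq (sumn b) n; last by rewrite fundF_size ?st.
by rewrite fundF_seq_mset ?st ?test_word_sorted // -e F_word_test.
Qed.

(** A strictly smaller set means fewer parts, the measure for the induction in
    [fundF_independent]. *)
Lemma comp_set_proper b c :
  is_comp b -> is_comp c -> sumn b = sumn c -> all (mem (comp_set c)) (comp_set b) ->
  b != c -> size b < size c.
Proof.
move=> cb cc e /allP sub n; rewrite ltnNge; apply: contra n => le.
have ub : uniq (comp_set b).
  exact: (sorted_uniq ltn_trans ltnn (comp_set_sorted cb)).
have sz d : size (comp_set d) = (size d).-1 by rewrite size_map size_iota.
have [|_ eqi] := uniq_min_size ub sub; first by rewrite !sz; lia.
apply/eqP; apply: comp_set_inj => //.
apply: (irr_sorted_eq ltn_trans ltnn) => //; exact: comp_set_sorted.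
Qed.

Lemma big_count_uniq (T : eqType) (L U : seq T) (f : T -> int) :
  uniq U -> {subset L <= U} ->
  (\sum_(b <- L) f b = \sum_(b <- U) (count_mem b L)%:Z * f b)%R.
Proof.
move=> uU; elim: L => [|x L IH] sub.
  by rewrite big_nil big1 // => b _; rewrite GRing.mul0r.
rewrite big_cons IH => [|y yL]; last by apply: sub; rewrite inE yL orbT.
have xU : x \in U by apply: sub; rewrite mem_head.
rewrite (bigD1_seq x) //= [in RHS](bigD1_seq x) //= eqxx.
rewrite GRing.addrA; congr (_ + _)%R; first by lia.
by apply: eq_bigr => b bx; rewrite eq_sym (negPf bx).
Qed.

(** The system is triangular: at the test word of [comp_set b0], any contributing composition other
    than [b0] has fewer parts, hence coefficient 0 by induction. *)
Lemma fundF_independent n (U : seq (seq nat)) (e : seq nat -> int) :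
  uniq U -> all is_comp U ->
  (forall m, \sum_(b <- U) e b * fundF b m = 0)%R ->
  forall b, b \in U -> sumn b = n -> e b = 0%R.
Proof.
move=> uU cU h b; move: {2}(size b).+1 (ltnSn (size b)) => k.
elim: k b => // k IH b0; rewrite ltnS => sb bU sn.
have := h (seq_mset (test_word n (comp_set b0))).
rewrite (bigD1_seq b0) //= fundF_test ?(allP cU) // sn eqxx.
have -> : all (mem (comp_set b0)) (comp_set b0) by apply/allP.
rewrite GRing.mulr1 big_seq_cond big1 ?GRing.addr0 // => b /andP[bin bn].
rewrite fundF_test ?(allP cU) //; case: eqP => /= [eb|_]; last by rewrite GRing.mulr0.
case: (boolP (all _ _)) => [sub|_]; last by rewrite GRing.mulr0.
rewrite IH ?GRing.mul0r //; apply: leq_trans sb.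
by apply: comp_set_proper sub bn; rewrite ?(allP cU) ?sn.
Qed.

(** * From quasisymmetric Schur functions to words *)

Lemma QSchur_mf a : F_multiplicity_free (QSchur a) <-> words_mf a.
Proof.
rewrite -com_inj_words; split=> [[s [c [us cs h c01]]]|inj]; last first.
  exists (map (com (sumn a)) (SCTs a)), (fun=> 1%R); split.
  - by rewrite map_inj_in_uniq ?undup_uniq.
  - by apply/allP => _ /mapP[T _ ->]; have [] := com_comp a T.
  - by move=> m; rewrite big_map; apply: eq_bigr => T _; rewrite GRing.mul1r.
  - by right.
set L := map (com (sumn a)) (SCTs a).
(* Both expansions are written over the common list [U], with coefficient 0 in place of [c] outside
   [s]; independence then equates multiplicities and coefficients. *)
pose U := s ++ [seq b <- undup L | b \notin s].
have uU : uniq U.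
  rewrite cat_uniq us filter_uniq ?undup_uniq // andbT; apply/hasPn => b.
  by rewrite mem_filter => /andP[].
have LU : {subset L <= U}.
  by move=> b bL; rewrite mem_cat mem_filter mem_undup bL andbT orbN.
have cU : all is_comp U.
  rewrite all_cat cs; apply/allP => b; rewrite mem_filter mem_undup.
  by case/andP=> _ /mapP[T _ ->]; have [] := com_comp a T.
pose C b : int := if b \in s then c b else 0%R.
have e0 b : b \in L -> ((count_mem b L)%:Z - C b = 0)%R.
  move=> bL; apply: (@fundF_independent (sumn a) U
    (fun b => (count_mem b L)%:Z - C b)%R uU cU _ b (LU _ bL)); last first.
    by case/mapP: bL => T _ ->; have [] := com_comp a T.
  move=> m; under eq_bigr do rewrite GRing.mulrBl.
  rewrite GRing.sumrB -(big_count_uniq _ uU LU).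
  apply/eqP; rewrite GRing.subr_eq0; apply/eqP.
  rewrite big_map -[LHS]/(QSchur a m) h big_cat /= [X in _ = (_ + X)%R]big_seq.
  rewrite [X in _ = (_ + X)%R]big1 ?GRing.addr0 => [|b'].
    by apply: eq_big_seq => b'; rewrite /C => ->.
  by rewrite mem_filter /C => /andP[/negPf-> _]; rewrite GRing.mul0r.
move=> T1 T2 T1s T2s eT; apply/eqP/negPn/negP => nT.
have bL : com (sumn a) T1 \in L by rewrite map_f.
have : count_mem (com (sumn a) T1) L <= 1.
  by have := e0 _ bL; rewrite /C; case: ifP => [/c01[]->|_]; lia.
rewrite count_map -size_filter.
(* Two tableaux with the same composition would give it multiplicity at least 2. *)
suff : size [:: T1; T2] <= size [seq T <- SCTs a | com (sumn a) T == com (sumn a) T1].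
  by move=> /= h1 h2; have := leq_trans h1 h2.
apply: uniq_leq_size => [|T]; first by rewrite /= inE nT.
by rewrite !inE mem_filter => /orP[]/eqP->; rewrite ?eqxx ?T1s ?eT ?eqxx.
Qed.

(** The criteria for the infinite families depend only on counts of parts, which rearrangement
    preserves; the sporadic partitions are checked on every permutation. *)
Lemma listed_mf n l a : listed n l -> perm_eq a l -> words_mf a.
Proof.
move=> h p; have ct q : count q a = count q l by apply/permP.
have al q : all q a = all q l by apply: perm_all.
case: h => [[k kn e]|[[k [n5 kn] e]|[[b [b2 bn] e]|[[n7 e]|h]]]].
- by apply: hook_mf; rewrite ct e /= count_nseq /=; lia.
- by apply: near_hook_mf; rewrite ct e /= count_nseq /=; lia.
- by apply: twos_mf; rewrite ?ct ?al e ?all_cat ?all_nseq ?count_cat ?count_nseq /=; lia.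
- by apply: threes_mf; rewrite ?ct ?al e /= ?all_nseq ?count_nseq /=; lia.
apply: mf_checkP; move: p; rewrite -mem_permutations; move: a {ct al}; apply/allP.
by case: h => [->|[->|->]]; vm_compute.
Qed.

Theorem theorem6p1 (n : nat) (l : seq nat) :
  0 < n -> is_partition_of n l ->
  (forall a : seq nat, in_angle l a -> F_multiplicity_free (QSchur a)) <->
  (exists2 k, 0 <= k <= n - 1 & l = (n - k) :: nseq k 1) \/
  (exists2 k, 5 <= n /\ 0 <= k <= n - 5 & l = [:: n - 2 - k, 2 & nseq k 1]) \/
  (exists2 a, 2 <= a <= 4 /\ 2 * a <= n
            & l = nseq a 2 ++ nseq (n - 2 * a) 1) \/
  (7 <= n /\ l = [:: 3, 2, 2 & nseq (n - 7) 1]) \/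
  (l = [:: 3; 3] \/ l = [:: 4; 3] \/ l = [:: 4; 4]).
Proof.
move=> n0 pl; split=> [mf|h a /andP[_ /eqP sa]].
  case: (listed_or_clash pl n0) => // -[b pb cb]; case: (clash_not_mf cb).
  apply/QSchur_mf/mf; case/and3P: pl => cl sl _.
  rewrite /in_angle /is_comp (perm_all _ pb) -/(is_comp l) cl /=; apply/eqP.
  have gT : transitive geq by move=> x y z /= yx zy; apply: leq_trans zy yx.
  have gA : antisymmetric geq by move=> x y /= /anti_leq ->.
  have gt : total geq by move=> x y; apply: leq_total.
  apply: (sorted_eq gT gA) => //; first exact: sort_sorted.
  by rewrite perm_sort.
by apply/QSchur_mf/(listed_mf h); rewrite -sa perm_sym perm_sort.
Qed.
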